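(* Let $G$ be a finite group, $p$ be a prime and $S$ be a Sylow $p$-subgroup of $G$. Suppose that there is a subgroup $D$ of $S$ with $1 < D < S$ such that every subgroup of $S$ with order $|D|$ or $p|D|$ is abelian and weakly pronormal in $G$. Then the fusion system $\mathcal{F}_S(G)$ is supersolvable.
   Context: For a Sylow $p$-subgroup $S$ of a finite group $G$, $\mathcal{F}_S(G)$ is the category whose objects are the subgroups of $S$, whose morphisms are the group homomorphisms between subgroups of $S$ induced by conjugation by elements of $G$, with the usual composition; it is a saturated fusion system on $S$. A subgroup $Q \le S$ is strongly $\mathcal{F}$-closed (for a fusion system $\mathcal{F}$ on $S$) if for every $P \le Q$ and every $\varphi \in \mathrm{Hom}_{\mathcal{F}}(P,S)$ one has $\varphi(P) \le Q$. A saturated fusion system $\mathcal{F}$ on a finite $p$-group $S$ is supersolvable if there is a series $1 = S_0 \le S_1 \le \dots \le S_m = S$ of subgroups of $S$ such that $S_i$ is strongly $\mathcal{F}$-closed for all $0 \le i \le m$ and $S_{i+1}/S_i$ is cyclic for all $0 \le i < m$. A subgroup $H$ of a group $G$ is pronormal in $G$ if $H$ and $H^g$ are conjugate in $\langle H, H^g \rangle$ for each $g \in G$. A subgroup $H$ of $G$ is weakly pronormal in $G$ if there is a subgroup $K$ of $G$ such that $G = HK$ and $H \cap K$ is pronormal in $G$. *)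

(* Defs.v *)
From mathcomp Require Import all_boot all_fingroup all_solvable.
Set Implicit Arguments.
Unset Strict Implicit.
Unset Printing Implicit Defensive.
Local Open Scope group_scope.

(* A fusion system on S: a category on the subgroups of S.  A morphism P -> Q *)
(* is given by some phi : {morphism P >-> gT} with phi @* P \subset Q; since  *)
(* such a phi is also defined outside P, only its values on P count, and      *)
(* fsys_comp (with psi the identity) makes fhom invariant under changing phi  *)
(* outside P.  Identities are the case s = 1 of fsys_conj.                    *)
Record fusion_system (gT : finGroupType) (S : {group gT}) := FusionSystem {
  fhom : forall P Q : {group gT}, {morphism P >-> gT} -> Prop;
  fsys_sub : forall (P Q : {group gT}) (phi : {morphism P >-> gT}),
    fhom Q phi ->
    [/\ P \subset S, Q \subset S, phi @* P \subset Q & 'injm phi];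
  fsys_conj : forall (P Q : {group gT}) (phi : {morphism P >-> gT}) (s : gT),
    P \subset S -> Q \subset S -> s \in S -> phi @* P \subset Q ->
    {in P, forall x, phi x = x ^ s} -> fhom Q phi;
  fsys_comp : forall (P Q R : {group gT}) (phi : {morphism P >-> gT})
      (psi : {morphism Q >-> gT}) (chi : {morphism P >-> gT}),
    fhom Q phi -> fhom R psi ->
    {in P, forall x, chi x = psi (phi x)} -> fhom R chi;
  fsys_corestr : forall (P Q : {group gT}) (phi : {morphism P >-> gT}),
    fhom Q phi -> fhom (phi @* P)%G phi;
  fsys_inv : forall (P Q : {group gT}) (phi : {morphism P >-> gT})
      (psi : {morphism (phi @* P)%G >-> gT}),
    fhom Q phi -> {in P, forall x, psi (phi x) = x} -> fhom P psi
}.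

Section GroupFusion.
Variables (gT : finGroupType) (S G : {group gT}).

Definition conj_hom (P Q : {group gT}) (phi : {morphism P >-> gT}) : Prop :=
  [/\ P \subset S, Q \subset S, phi @* P \subset Q &
      exists2 g, g \in G & {in P, forall x, phi x = x ^ g}].

Lemma conj_hom_sub (P Q : {group gT}) (phi : {morphism P >-> gT}) :
  conj_hom Q phi ->
  [/\ P \subset S, Q \subset S, phi @* P \subset Q & 'injm phi].
Proof.
case=> sPS sQS sPQ [g _ phiE]; split=> //.
by apply/injmP=> x y Px Py; rewrite !phiE // => /conjg_inj.
Qed.

Lemma conj_hom_conj (sSG : S \subset G)
    (P Q : {group gT}) (phi : {morphism P >-> gT}) (s : gT) :
  P \subset S -> Q \subset S -> s \in S -> phi @* P \subset Q ->
  {in P, forall x, phi x = x ^ s} -> conj_hom Q phi.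
Proof. by move=> sPS sQS Ss sPQ phiE; split=> //; exists s => //; apply: (subsetP sSG). Qed.

Lemma conj_hom_comp (P Q R : {group gT}) (phi : {morphism P >-> gT})
    (psi : {morphism Q >-> gT}) (chi : {morphism P >-> gT}) :
  conj_hom Q phi -> conj_hom R psi ->
  {in P, forall x, chi x = psi (phi x)} -> conj_hom R chi.
Proof.
case=> sPS _ sPQ [g Gg phiE] [_ sRS sQR [h Gh psiE]] chiE.
have Qphi x : x \in P -> phi x \in Q.
  by move=> Px; apply: (subsetP sPQ); apply: mem_morphim.
split=> //.
  apply/subsetP=> _ /morphimP[x _ Px ->]; rewrite chiE //.
  by apply: (subsetP sQR); apply: mem_morphim; apply: Qphi.
exists (g * h) => [|x Px]; first exact: groupM.
by rewrite chiE // psiE ?Qphi // phiE // conjgM.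
Qed.

Lemma conj_hom_corestr (P Q : {group gT}) (phi : {morphism P >-> gT}) :
  conj_hom Q phi -> conj_hom (phi @* P)%G phi.
Proof. by case=> sPS sQS sPQ ?; split=> //; apply: subset_trans sQS. Qed.

Lemma conj_hom_inv (P Q : {group gT}) (phi : {morphism P >-> gT})
    (psi : {morphism (phi @* P)%G >-> gT}) :
  conj_hom Q phi -> {in P, forall x, psi (phi x) = x} -> conj_hom P psi.
Proof.
case=> sPS sQS sPQ [g Gg phiE] psiK; split=> //.
- exact: subset_trans sQS.
- by apply/subsetP=> _ /morphimP[_ _ /morphimP[x _ Px ->] ->]; rewrite psiK.
exists g^-1 => [|_ /morphimP[x _ Px ->]]; first exact: groupVr.
by rewrite psiK // phiE // conjgK.
Qed.

Definition group_fusion (sSG : S \subset G) : fusion_system S :=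
  FusionSystem conj_hom_sub (conj_hom_conj sSG) conj_hom_comp conj_hom_corestr
    conj_hom_inv.

End GroupFusion.

Definition strongly_closed (gT : finGroupType) (S : {group gT})
    (F : fusion_system S) (Q : {group gT}) : Prop :=
  Q \subset S /\
  forall (P : {group gT}) (phi : {morphism P >-> gT}),
    P \subset Q -> fhom F S phi -> phi @* P \subset Q.

(* Usually defined for saturated F; saturation is not part of the predicate,  *)
(* being a theorem for F_S(G) with S Sylow in G.  A strongly closed subgroup  *)
(* is normal in S (by fsys_conj), so T i.+1 / T i is a genuine quotient.      *)
Definition supersolvable_fusion (gT : finGroupType) (S : {group gT})
    (F : fusion_system S) : Prop :=
  exists (m : nat) (T : nat -> {group gT}),
    [/\ T 0 = 1%G, T m = S,
        forall i, i <= m -> strongly_closed F (T i)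
      & forall i, i < m -> T i \subset T i.+1 /\ cyclic (T i.+1 / T i)].

Definition pronormal (gT : finGroupType) (G H : {group gT}) : Prop :=
  H \subset G /\
  forall g, g \in G -> exists2 x, x \in H <*> H :^ g & H :^ g = H :^ x.

Definition weakly_pronormal (gT : finGroupType) (G H : {group gT}) : Prop :=
  H \subset G /\
  exists K : {group gT},
    [/\ K \subset G, H * K = G :> {set gT} & pronormal G (H :&: K)%G].

(* Main.v *)
Require Import Defs.
From mathcomp Require Import all_boot all_fingroup all_algebra all_solvable.
From mathcomp Require Import all_field all_character.
Set Implicit Arguments.
Unset Strict Implicit.
Unset Printing Implicit Defensive.
Local Open Scope group_scope.

(* For a group N let B(N) be the subgroup generated by the p'-elements of    *)
(* N' N^(p-1).  On a normal p-subgroup Q of N all N-chief factors have order *)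
(* p exactly when B(N) centralizes Q.                                        *)
(* If H <= Q <| N and H is weakly pronormal in G >= N, Dedekind's law gives  *)
(* N = HM with H :&: M pronormal, hence normal, in N.  When this holds for   *)
(* all H <= Q of orders d and pd, 1 < d < |Q|, and these H are abelian, B(N) *)
(* centralizes Q: in a minimal counterexample Q = [Q, B(N)], every proper    *)
(* normal X <= Q has |X| = 1 or |X| >= d, with X centralized by B(N) if      *)
(* |X| > d, and a supplement M of an H lying in no U with Q/U a chief factor *)
(* produces a second such U, leaving no room for Q.                          *)
(* A subgroup R of S with 'C_S(R) <= R has order > d, since subgroups of     *)
(* order pd are abelian.  So this applies to N = 'N_G(R), and 'N_G(R) has a  *)
(* normal subgroup 'C_G(R)'N_S(R).  By Frattini and induction as in Alperin's*)
(* fusion theorem, 'N_G(S) controls fusion in S, and a chain of normal       *)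
(* subgroups of 'N_G(S) with factors of order p is strongly closed.          *)

(** * The residual B(N) and its action on p-groups *)

(** Once ['N_G(S)] controls fusion in [S], every subgroup of [S] normal in ['N_G(S)] is strongly
    closed. So two things are needed: control ([control_norm_Sylow]) and an ['N_G(S)]-invariant
    chain in [S] with factors of order p ([cyclic_normal_chain]). Both rest on
    [ss_res_cent_normal_pgroup]: for N <= G, [ss_res p N] centralizes each normal p-subgroup of [N]
    that lies in [S] and has order above |D|.

    The chain is the case of [S] in ['N_G(S)], because a chief factor centralized by the residual
    has order p ([minnormal_ss_res_card]). For control, a centric [R] is taken in ['N_G(R)]. There
    ['C_G(R)] contains the residual, so [ss_res_cent_Sylow_normal] and a Frattini argument show that
    ['N_G(R)] acts on [R] through elements normalizing a larger subgroup of [S].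

    Weak pronormality enters through [weakly_pronormal_c_supplemented] alone; what remains is an
    induction on |Q|, closed by [minimal_counterexample]. *)

Section Residual.

Variable p : nat.
Implicit Types gT : finGroupType.

(** For prime p, the least normal subgroup of a group [N] with abelian quotient of exponent dividing
    p - 1, the kind of group that [N] can induce on a factor of order p. *)
Definition abexp_res gT (N : {set gT}) : {set gT} :=
  <<commg_set N N :|: [set x ^+ p.-1 | x in N]>>.

(* Strictly p-closed residual: the B(N) of the header. *)
Definition ss_res gT (N : {set gT}) : {set gT} :=
  <<[set x in abexp_res N | p^'.-elt x]>>.

Canonical abexp_res_group gT (N : {set gT}) := Eval hnf in [group of abexp_res N].
Canonical ss_res_group gT (N : {set gT}) := Eval hnf in [group of ss_res N].

Lemma abexp_res_sub gT (N : {group gT}) : abexp_res N \subset N.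
Proof.
rewrite gen_subG subUset; apply/andP; split.
  by apply/subsetP=> _ /imset2P[x y Nx Ny ->]; rewrite groupR.
by apply/subsetP=> _ /imsetP[x Nx ->]; rewrite groupX.
Qed.

Lemma abexp_res_norm gT (N : {group gT}) : N \subset 'N(abexp_res N).
Proof.
apply/subsetP=> y Ny; rewrite inE -genJ genS //; apply/subsetP=> z.
rewrite mem_conjg !inE => /orP[/imset2P[u v Nu Nv def_z]|/imsetP[u Nu def_z]].
  rewrite -[z](conjgKV y) def_z conjRg /= ; apply/orP; left.
  by rewrite imset2_f ?groupJ.
rewrite -[z](conjgKV y) def_z conjXg; apply/orP; right.
by apply: imset_f; rewrite groupJ.
Qed.

Lemma der1_abexp_res gT (N : {group gT}) : N^`(1) \subset abexp_res N.
Proof. by rewrite genS ?subsetUl. Qed.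

Lemma abexp_resX gT (N : {group gT}) x : x \in N -> x ^+ p.-1 \in abexp_res N.
Proof. by move=> Nx; rewrite mem_gen //; apply/setUP; right; apply: imset_f. Qed.

Lemma quotient_abexp_res gT (N V : {group gT}) :
  V <| N -> abexp_res N / V = abexp_res (N / V).
Proof.
case/andP=> sVN nVN; rewrite /quotient morphim_gen; last first.
  by rewrite (subset_trans _ nVN) // -gen_subG abexp_res_sub.
congr <<_>>; rewrite morphimU; congr (_ :|: _).
  apply/setP=> z; apply/morphimP/imset2P=> [[x Nx /imset2P[u v Nu Nv ->]] ->|].
    by exists (coset V u) (coset V v); rewrite ?mem_quotient ?morphR ?(subsetP nVN).
  case=> _ _ /morphimP[u nVu Nu ->] /morphimP[v nVv Nv ->] ->.
  by exists [~ u, v]; rewrite ?groupR ?imset2_f ?morphR.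
apply/setP=> z; apply/morphimP/imsetP=> [[x Nx /imsetP[u Nu ->]] ->|].
  by exists (coset V u); rewrite ?mem_quotient ?morphX ?(subsetP nVN).
case=> _ /morphimP[u nVu Nu ->] ->.
by exists (u ^+ p.-1); rewrite ?groupX ?morphX //; apply: imset_f.
Qed.

Lemma ss_res_sub_abexp gT (N : {group gT}) : ss_res N \subset abexp_res N.
Proof. by rewrite gen_subG; apply/subsetP=> x; rewrite inE => /andP[]. Qed.

Lemma ss_res_sub gT (N : {group gT}) : ss_res N \subset N.
Proof. exact: subset_trans (ss_res_sub_abexp N) (abexp_res_sub N). Qed.

Lemma ss_res_norm gT (N : {group gT}) : N \subset 'N(ss_res N).
Proof.
apply/subsetP=> y Ny; rewrite inE -genJ genS //; apply/subsetP=> z.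
rewrite mem_conjg !inE p_eltJ => /andP[Kz ->]; rewrite andbT.
by rewrite -mem_conjg (normsP (abexp_res_norm N)) in Kz.
Qed.

Lemma quotient_ss_res gT (N V : {group gT}) :
  V <| N -> ss_res N / V \subset ss_res (N / V).
Proof.
move=> nsVN; have [sVN nVN] := andP nsVN.
rewrite /quotient morphim_gen; last first.
  by rewrite -gen_subG (subset_trans (ss_res_sub N)).
apply: genS; apply/subsetP=> _ /morphimP[x nVx /setIdP[Kx p'x] ->].
by rewrite inE -quotient_abexp_res // mem_quotient // morph_p_elt.
Qed.

Lemma ss_res_quotient gT (N V : {group gT}) :
  V <| N -> ss_res (N / V) \subset ss_res N / V.
Proof.
move=> nsVN; have [sVN nVN] := andP nsVN.
rewrite gen_subG; apply/subsetP=> z; rewrite inE -quotient_abexp_res //.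
case/andP=> /morphimP[x nVx Kx ->] p'z.
rewrite -(constt_p_elt p'z) -morph_constt // mem_quotient //.
by rewrite mem_gen // inE p_elt_constt groupX.
Qed.

(** [A] centralizes [Q / H], and fixed points of a coprime action lift from the quotient. *)
Lemma coprime_commg_cent_factor gT (Q H A : {group gT}) :
    p.-group Q -> p^'.-group A -> H <| Q -> A \subset 'N(H) ->
  [~: Q, A] \subset H -> A \subset 'N(Q) -> Q :=: H * 'C_Q(A).
Proof.
move=> pQ p'A /andP[sHQ nHQ] nHA sQAH nQA.
have coQA: coprime #|Q| #|A| := pnat_coprime pQ p'A.
apply/eqP; rewrite eqEsubset mul_subG ?subsetIl // andbT.
rewrite -quotientSK // (coprime_quotient_cent sHQ) ?(pgroup_sol pQ) //.
by rewrite subsetI subxx quotient_cents2r.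
Qed.

Lemma coprime_cent_chain gT (Q H A : {group gT}) :
    p.-group Q -> p^'.-group A -> H <| Q -> A \subset 'N(Q) ->
  [~: Q, A] \subset H -> A \subset 'C(H) -> A \subset 'C(Q).
Proof.
move=> pQ p'A nsHQ nQA sQAH cHA.
have:= coprime_commg_cent_factor pQ p'A nsHQ (cents_norm cHA) sQAH nQA => ->.
by rewrite centsC mul_subG ?subsetIr // centsC.
Qed.

Lemma coprime_cent_Phi gT (Q A : {group gT}) :
    p.-group Q -> p^'.-group A -> A \subset 'N(Q) ->
  [~: Q, A] \subset 'Phi(Q) -> A \subset 'C(Q).
Proof.
move=> pQ p'A nQA sQAPhi.
have nPhiA: A \subset 'N('Phi(Q)) := char_norm_trans (Phi_char Q) nQA.
have defQ := coprime_commg_cent_factor pQ p'A (Phi_normal Q) nPhiA sQAPhi nQA.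
rewrite centsC; apply/setIidPl; rewrite -['C_Q(A)]genGid; apply: Phi_nongen.
apply/eqP; rewrite eqEsubset join_subG Phi_sub subsetIl /=.
by rewrite {1}defQ mulG_subG joing_subl joing_subr.
Qed.

(** [ss_res N] need not be a p'-group, so coprime action is applied to one cyclic p'-subgroup at a
    time. *)
Lemma cent_ss_resP gT (N Q : {group gT}) :
    (forall x, x \in abexp_res N -> p^'.-elt x -> <[x]> \subset 'C(Q)) ->
  ss_res N \subset 'C(Q).
Proof.
move=> cQ; rewrite gen_subG; apply/subsetP=> x /setIdP[Kx p'x].
by rewrite -cycle_subG cQ.
Qed.

Lemma cycle_sub_ss_res gT (N : {group gT}) x :
  x \in abexp_res N -> p^'.-elt x -> <[x]> \subset ss_res N.
Proof. by move=> Kx p'x; rewrite cycle_subG mem_gen // inE Kx. Qed.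

Lemma ss_res_cent_chain gT (N Q H : {group gT}) :
    p.-group Q -> N \subset 'N(Q) -> H <| Q ->
  [~: Q, ss_res N] \subset H -> ss_res N \subset 'C(H) ->
  ss_res N \subset 'C(Q).
Proof.
move=> pQ nQN nsHQ sQBH cHB; apply: cent_ss_resP => x Kx p'x.
have sxB := cycle_sub_ss_res Kx p'x.
apply: coprime_cent_chain pQ p'x nsHQ _ _ (subset_trans sxB cHB).
  exact: subset_trans (subset_trans sxB (ss_res_sub N)) nQN.
exact: subset_trans (commgS Q sxB) sQBH.
Qed.

Lemma ss_res_cent_Phi gT (N Q : {group gT}) :
    p.-group Q -> N \subset 'N(Q) ->
  [~: Q, ss_res N] \subset 'Phi(Q) -> ss_res N \subset 'C(Q).
Proof.
move=> pQ nQN sQBH; apply: cent_ss_resP => x Kx p'x.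
have sxB := cycle_sub_ss_res Kx p'x.
apply: coprime_cent_Phi pQ p'x _ (subset_trans (commgS Q sxB) sQBH).
exact: subset_trans (subset_trans sxB (ss_res_sub N)) nQN.
Qed.

(** [N] acts on [L] through [Aut L], abelian of order p - 1, so commutators and (p-1)-st powers act
    trivially. *)
Lemma ss_res_cent_prime gT (N L : {group gT}) :
  prime p -> #|L| = p -> N \subset 'N(L) -> ss_res N \subset 'C(L).
Proof.
move=> p_pr oL nLN; apply: subset_trans (ss_res_sub_abexp N) _.
have cycL: cyclic L by rewrite prime_cyclic ?oL.
have AutN x : x \in N -> conj_aut L x \in Aut L by rewrite Aut_aut.
have cAut := centsP (Aut_cyclic_abelian cycL).
suffices: abexp_res N \subset 'ker (conj_aut L) by rewrite ker_conj_aut.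
rewrite gen_subG; apply/subsetP=> z /setUP[].
  case/imset2P=> x y Nx Ny ->; have [Lx Ly]: x \in 'N(L) /\ y \in 'N(L).
    by split; apply: subsetP nLN _ _.
  apply/kerP; rewrite ?groupR // morphR //; apply/eqP/commgP.
  by apply: cAut; apply: AutN.
case/imsetP=> x Nx ->; have Lx := subsetP nLN x Nx.
apply/kerP; rewrite ?groupX // morphX //.
have ->: p.-1 = #|Aut L| by rewrite card_Aut_cyclic // totient_prime // oL.
by rewrite expg_cardG ?AutN.
Qed.

Lemma ss_res_comm_index gT (N Q V : {group gT}) :
    prime p -> V <| N -> V <| Q -> N \subset 'N(Q) -> #|Q : V| = p ->
  [~: Q, ss_res N] \subset V.
Proof.
move=> p_pr nsVN nsVQ nQN iQV; have [_ nVN] := andP nsVN.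
have [_ nVQ] := andP nsVQ.
have oQV : #|Q / V| = p by rewrite card_quotient.
rewrite -quotient_cents2 ?(subset_trans (ss_res_sub N)) // centsC.
apply: subset_trans (quotient_ss_res nsVN) _.
by apply: ss_res_cent_prime; rewrite ?quotient_norms.
Qed.

End Residual.

(* All p-1st roots of unity lie in F_p, so a matrix killed by X^p - X has an *)
(* eigenvalue in F_p.                                                        *)
Lemma abelem_eigenvector (p : nat) (gT : finGroupType) (U : {group gT}) a :
    prime p -> p.-abelem U -> U :!=: 1 -> a \in 'N(U) -> a ^+ p.-1 \in 'C(U) ->
  exists u k, [/\ u \in U, u != 1 & u ^ a = u ^+ k].
Proof.
move=> p_pr abelU ntU nUa cUap.
have nUA: <[a]> \subset 'N(U) by rewrite cycle_subG.
pose rA := abelem_repr abelU ntU nUA; pose A := rA a.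
have Aa: a \in <[a]> := cycle_id a.
have A1: (A ^+ p.-1 = 1)%R.
  rewrite -repr_mxX //; apply/row_matrixP=> i; rewrite rowE [RHS]rowE mulmx1.
  apply: (@rVabelem_inj _ _ _ abelU ntU); rewrite rVabelemJ ?groupX //.
  by rewrite /conjg -(centP cUap) ?mulKg ?mem_rVabelem.
have Ap: (A ^+ p = A)%R.
  rewrite -[RHS]GRing.mulr1 -A1 -GRing.exprS; congr (_ ^+ _)%R.
  by rewrite prednK ?prime_gt0.
(* X^p - X is the product of all X - x with x in F_p, so some A - x is singular. *)
have: (\det (horner_mx A (\prod_(x : 'F_p) ('X - x%:P))) = 0)%R.
  rewrite -finField_genPoly card_Fp // GRing.rmorphB /= GRing.rmorphXn /= horner_mx_X.
  by rewrite Ap GRing.subrr det0.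
rewrite GRing.rmorph_prod (big_morph _ (@det_mulmx _ _) (@det1 _ _)) => /eqP.
rewrite GRing.prodf_seq_eq0 => /hasP[x _ /= /det0P[v nz_v]].
rewrite GRing.rmorphB /= horner_mx_X horner_mx_C mulmxBr mul_mx_scalar => /eqP.
rewrite GRing.subr_eq0 => /eqP vA.
exists (rVabelem abelU ntU v), x; split; rewrite ?mem_rVabelem //.
  by rewrite -(rVabelem0 abelU ntU) (inj_eq (@rVabelem_inj _ _ _ abelU ntU)).
by rewrite -rVabelemZ -vA rVabelemJ.
Qed.

(** * Chief factors centralized by the residual *)

Lemma pgroup_quotient_p'_elt (p : nat) (gT : finGroupType) (K C : {group gT}) :
    K \subset 'N(C) -> {in K, forall x, p^'.-elt x -> x \in C} -> p.-group (K / C).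
Proof.
move=> nCK p'KC; apply/pgroupP=> q q_pr.
case/(Cauchy q_pr) => _ /morphimP[x nCx Kx ->] oxC; apply/idPn => p'q.
suff xC1: coset C x = 1 by move: q_pr; rewrite -oxC /= xC1 order1.
have p'xC: p^'.-elt (coset C x) by rewrite /p_elt oxC pnatE.
rewrite -(constt_p_elt p'xC) -morph_constt //; apply: coset_id.
by apply: p'KC; rewrite ?groupX ?p_elt_constt.
Qed.

(** [K] induces a p-group on [U], hence has nontrivial fixed points there; by minimality it
    centralizes [U]. So [N] acts on [U] as an abelian group of exponent dividing p - 1. Each element
    has an eigenvector, and its eigenspace is [N]-invariant, hence all of [U]. As [N] acts by
    scalars, every [<[u]>] is [N]-invariant. *)
Lemma minnormal_ss_res_card (p : nat) (gT : finGroupType) (N U : {group gT}) :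
    prime p -> p.-group U -> minnormal U N -> U \subset N ->
  ss_res p N \subset 'C(U) -> #|U| = p.
Proof.
move=> p_pr pU minU sUN cUB; set K := abexp_res_group p N.
have [/andP[ntU nUN] minUN] := mingroupP minU.
have solU := pgroup_sol pU.
have abelU: p.-abelem U.
  rewrite -(is_abelem_pgroup pU).
  exact: charsimple_solvable (minnormal_charsimple minU) solU.
have cUU := abelem_abelian abelU.
have sKN: K \subset N := abexp_res_sub p N.
have nsCK: 'C_K(U) <| K.
  by rewrite /normal subsetIl normsI ?normG ?norms_cent ?(subset_trans sKN).
have pKC: p.-group (K / 'C_K(U)).
  apply: pgroup_quotient_p'_elt; rewrite ?normal_norm // => x Kx p'x; rewrite inE Kx.
  by rewrite -cycle_subG (subset_trans _ cUB) ?cycle_sub_ss_res.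
have [P sylP] := Sylow_exists p K; have sPK := pHall_sub sylP.
have pP := pHall_pgroup sylP.
have nCP: P \subset 'N('C_K(U)) := subset_trans sPK (normal_norm nsCK).
have sKCP: K \subset 'C_K(U) * P.
  rewrite -quotientSK ?(normal_norm nsCK) //.
  have sylPC := quotient_pHall nCP sylP.
  by rewrite (sub_pHall sylPC pKC) ?quotientS.
have nUP: P \subset 'N(U) := subset_trans (subset_trans sPK sKN) nUN.
have nsUUP: U <| U <*> P by rewrite normalYl.
have pUP: p.-group (U <*> P) by rewrite norm_joinEr // pgroupM pU.
have: U :&: 'Z(U <*> P) != 1 by apply: meet_center_nil; rewrite ?(pgroup_nil pUP).
have sZC: U :&: 'Z(U <*> P) \subset 'C_U(K).
  rewrite subsetI subsetIl centsC; apply: subset_trans sKCP _.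
  rewrite mul_subG //; first by rewrite subIset // orbC centS // subsetIl.
  rewrite centsC; apply: subset_trans (subsetIr _ _) _.
  by apply: subset_trans (subsetIr _ _) (centS (joing_subr _ _)).
rewrite -subG1 => ntZ; have ntCK: 'C_U(K) != 1.
  by apply: contraNneq ntZ => <-.
have cUK: K \subset 'C(U).
  rewrite centsC; apply/setIidPl; apply: (minUN 'C_U(K)%G); last exact: subsetIl.
  by rewrite ntCK normsI ?norms_cent ?abexp_res_norm.
have scal a : a \in N -> exists k, {in U, forall v, v ^ a = v ^+ k}.
  move=> Na; have nUa := subsetP nUN a Na.
  have cUa: a ^+ p.-1 \in 'C(U) by rewrite (subsetP cUK) // abexp_resX.
  have [u [k [Uu ntu ua]]] := abelem_eigenvector p_pr abelU ntU nUa cUa.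
  exists k; pose E := [set v in U | v ^ a == v ^+ k].
  have groupE: group_set E.
    apply/group_setP; split=> [|v w]; first by rewrite inE group1 conj1g expg1n /=.
    case/setIdP=> Uv /eqP va /setIdP[Uw /eqP wa].
    by rewrite inE groupM //= conjMg va wa expgMn //; apply: (centsP cUU).
  suff EU: Group groupE = U :> {set gT}.
    by move=> v; rewrite -{1}EU => /setIdP[_ /eqP].
  apply: minUN; last by apply/subsetP=> v /setIdP[].
  apply/andP; split.
    by apply/trivgPn; exists u; rewrite // inE Uu ua eqxx.
  apply/subsetP=> n Nn; rewrite inE; apply/subsetP=> _ /imsetP[v /setIdP[Uv /eqP va] ->].
  have nUn := subsetP nUN n Nn; rewrite inE memJ_norm ?Uv //=.
  rewrite -conjXg -va -!conjgM.
  have cna: [~ a, n] \in 'C(U).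
    by rewrite (subsetP cUK) ?(subsetP (der1_abexp_res p N)) ?mem_commg.
  rewrite (commgC a n) (conjgM _ _ [~ a, n]) [_ ^ [~ a, n]]conjgE.
  by rewrite -(centP cna) ?mulKg ?memJ_norm ?groupM ?(subsetP nUN).
have [u Uu ntu] := trivgPn _ ntU.
have ou := abelem_order_p abelU Uu ntu.
suff <-: <[u]> = U by rewrite -orderE.
apply: minUN; last by rewrite cycle_subG.
rewrite cycle_eq1 ntu /=; apply/subsetP=> a Na.
by have [k Uk] := scal a Na; rewrite inE -cycleJ cycle_subG Uk // mem_cycle.
Qed.

(** * Normal p-subgroups all of whose subgroups of two orders are c-supplemented *)

Definition c_supplemented (gT : finGroupType) (N H : {group gT}) : Prop :=
  exists2 M : {group gT}, H * M = N & H :&: M <| N.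

Lemma c_supplemented_quotient (gT : finGroupType) (N H L : {group gT}) :
    L <| N -> L \subset H -> c_supplemented N H ->
  c_supplemented (N / L)%G (H / L)%G.
Proof.
move=> nsLN sLH [M defN nsTN]; have [sLN nLN] := andP nsLN.
have sHN : H \subset N by rewrite -defN mulG_subl.
exists (M / L)%G; first by rewrite /= -quotientMl ?defN ?(subset_trans sHN).
by rewrite -quotientGI ?quotient_normal.
Qed.

(** Descending from [Q] through maximal subgroups over [H] divides the order by p each time, so no
    power of p is skipped. *)
Lemma exists_pgroup_between (p k : nat) (gT : finGroupType) (H Q : {group gT}) :
    p.-group Q -> H \subset Q -> #|H| <= p ^ k <= #|Q| ->
  exists K : {group gT}, [/\ H \subset K, K \subset Q & #|K| = (p ^ k)%N].
Proof.
have [n leQn] := ubnP #|Q|; elim: n => // n IHn in Q leQn *.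
move=> pQ sHQ /andP[leHk]; rewrite leq_eqVlt => /predU1P[-> | ltkQ].
  by exists Q.
case: (maximal_exists sHQ) => [eqHQ | [M maxM sHM]].
  by move: ltkQ; rewrite -eqHQ ltnNge leHk.
have ltMQ := proper_card (maxgroupp maxM).
have sMQ := proper_sub (maxgroupp maxM); have pM := pgroupS sMQ pQ.
have lekM: p ^ k <= #|M|.
  have iMQ := p_maximal_index pQ maxM.
  have p_gt0: 0 < p by rewrite -iMQ indexg_gt0.
  have p_gt1: 1 < p by rewrite -iMQ indexg_gt1; case/andP: (maxgroupp maxM).
  rewrite (card_pgroup pM) leq_exp2l // -ltnS -(@ltn_exp2l p) // expnS.
  by rewrite -(card_pgroup pM) -{2}iMQ mulnC Lagrange.
have [||||K [sHK sKM oK]] := IHn M; rewrite ?leHk //.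
  exact: leq_trans ltMQ _.
by exists K; rewrite (subset_trans sKM).
Qed.

(* A maximal subgroup over M meets Q in R, which is normalized by M and by   *)
(* the elements of Q in N_Q(R) outside R.                                    *)
Lemma normal_supplement (p : nat) (gT : finGroupType) (N Q H M : {group gT}) :
    p.-group Q -> Q <| N -> H \subset Q -> H * M = N -> M :!=: N ->
  exists R : {group gT}, [/\ R <| N, R \proper Q & H * R = Q].
Proof.
move=> pQ /andP[sQN nQN] sHQ defN neqMN.
have sMN: M \subset N by rewrite -defN mulG_subr.
case: (maximal_exists sMN) => [/eqP/idPn[] // | [M0 maxM0 sMM0]].
have [/andP[sM0N _] maxM0N] := maxgroupP maxM0.
have HM0: H * M0 = N.
  apply/eqP; rewrite eqEsubset -{2}defN mulgS // andbT.
  by rewrite mul_subG ?(subset_trans sHQ).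
have sQM0: ~~ (Q \subset M0).
  apply: contraL (maxgroupp maxM0) => sQM0.
  by rewrite -HM0 mulSGid ?properxx ?(subset_trans sHQ).
have prR: Q :&: M0 \proper Q by rewrite properE subsetIl subsetI subxx.
exists (Q :&: M0)%G; split=> //; last first.
  by rewrite /= setIC group_modl // HM0 (setIidPr sQN).
have nRM0: M0 \subset 'N(Q :&: M0) by rewrite normsI ?normG ?(subset_trans sM0N).
have [_ [x /setIP[Qx nRx] Rx]] := properP (nilpotent_proper_norm (pgroup_nil pQ) prR).
rewrite /normal subIset ?sQN //=; apply/idPn => nRN.
have/maxM0N: 'N_N(Q :&: M0) \proper N by rewrite properE subsetIl subsetI subxx.
rewrite subsetI sM0N nRM0 => /(_ isT) defM0; case/negP: Rx.
by rewrite inE Qx -defM0 inE (subsetP sQN).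
Qed.

Lemma dvdn_bin_square p : prime p -> p %| 'C(p ^ 2, 2).
Proof.
move=> p_pr; have [-> // | p'2] := eqVneq p 2.
have co_p2: coprime p 2 by rewrite prime_coprime // dvdn_prime2.
by rewrite -(Gauss_dvdr _ co_p2) mul_bin_left bin1 dvdn_mull // dvdn_exp.
Qed.

(** [Q] has class at most 2, so (uv)^n = u^n v^n [v,u]^C(n,2), applied to [x,b] = x^-1 x^b. The
    commutator has order dividing p, and [b] fixes x^(p^2). The exponent p^2 covers p = 2: C(4,2) is
    even, C(2,2) is not. *)
Lemma commg_expn_square (p : nat) (gT : finGroupType) (Q U : {group gT}) x b :
    prime p -> Q^`(1) \subset U -> Q \subset 'C(U) ->
    {in Q, forall y, y ^+ p \in U} -> x \in Q -> b \in 'N(Q) -> b \in 'C(U) ->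
  [~ x, b] ^+ (p ^ 2) = 1.
Proof.
move=> p_pr sQ'U cQU powU Qx nQb cUb.
have Qxb : x ^ b \in Q by rewrite memJ_norm.
set w := x ^ b in Qxb *; set c := [~ w, x^-1].
have Uc : c \in U by rewrite (subsetP sQ'U) // derg1 mem_commg ?groupV.
have cUQ := centsP cQU.
have cp1 : c ^+ p = 1.
  rewrite -commXg; last by apply: cUQ.
  by apply/eqP/commgP/commute_sym/cUQ; rewrite ?groupV ?powU.
rewrite commgEl expMg_Rmul; try by apply: cUQ; rewrite ?groupV.
rewrite -/w -/c; have /dvdnP[m ->] := dvdn_bin_square p_pr.
rewrite (mulnC m) (expgM c) cp1 expg1n mulg1 /w -conjXg [_ ^ b]conjgE.
have Uxp2 : x ^+ (p ^ 2) \in U by rewrite expgM groupX ?powU.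
by rewrite -(centP cUb) // mulKg expVgn mulVg.
Qed.

(** * Maximal [N]-invariant subgroups and the minimal counterexample *)

Lemma maxnormal_exists (gT : finGroupType) (N Q X : {group gT}) :
    N \subset 'N(X) -> X \proper Q ->
  {U : {group gT} | maxnormal U Q N & X \subset U}.
Proof.
move=> nXN prX.
have PX: (X \proper Q) && (N \subset 'N(X)) by rewrite prX.
have [U maxU sXU] :=
  @maxgroup_exists _ (fun Y : {group gT} => (Y \proper Q) && (N \subset 'N(Y))) X PX.
by exists U.
Qed.

Lemma maxnormal_index_prime (p : nat) (gT : finGroupType) (N Q U : {group gT}) :
    prime p -> p.-group Q -> Q <| N -> maxnormal U Q N ->
  [~: Q, ss_res p N] \subset U -> #|Q : U| = p.
Proof.
move=> p_pr pQ nsQN maxU sWU; have sQN := normal_sub nsQN.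
have [/andP[prU nUN] _] := maxgroupP maxU; have sUQ := proper_sub prU.
have nsUN: U <| N by rewrite /normal (subset_trans sUQ).
rewrite -card_quotient ?(subset_trans sQN) //.
apply: (@minnormal_ss_res_card p _ (N / U)%G) => //; first exact: quotient_pgroup.
- by apply: chief_factor_minnormal; rewrite /chief_factor maxU.
- exact: quotientS.
apply: subset_trans (ss_res_quotient p nsUN) _.
rewrite centsC quotient_cents2 ?(subset_trans sQN) //.
exact: subset_trans (ss_res_sub p N) nUN.
Qed.

(** Stated inside [N] alone, this passes to subgroups of [Q] and, with [e] lowered, to quotients, as
    the induction requires. *)
Definition csuppl_hyp (p e : nat) (gT : finGroupType) (N Q : {group gT}) : Prop :=
  forall H : {group gT}, H \subset Q -> #|H| = (p ^ e)%N \/ #|H| = (p ^ e.+1)%N ->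
  abelian H /\ c_supplemented N H.

(* F1 is what induction gives for (N, X), and F2 for (N / L, Q / L).         *)
Section MinimalCounterexample.

Variables (p e : nat) (gT : finGroupType) (N Q : {group gT}).
Hypotheses (p_pr : prime p) (pQ : p.-group Q) (nsQN : Q <| N).
Hypotheses (e_gt0 : 0 < e) (lteQ : p ^ e < #|Q|) (hypQ : csuppl_hyp p e N Q).
Local Notation B := (ss_res p N).
Local Notation W := [~: Q, B].
Hypothesis F1 : forall X : {group gT},
  X <| N -> X \proper Q -> p ^ e < #|X| -> B \subset 'C(X).
Hypothesis F2 : forall L : {group gT},
  L <| N -> L \subset Q -> L :!=: 1 -> #|L| < p ^ e -> W \subset L.
Hypothesis badQ : ~~ (B \subset 'C(Q)).

Let sQN : Q \subset N := normal_sub nsQN.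
Let nQN : N \subset 'N(Q) := normal_norm nsQN.
Let sBN : B \subset N := ss_res_sub p N.
Let nQB : B \subset 'N(Q) := subset_trans sBN nQN.
Let p_gt0 : 0 < p := prime_gt0 p_pr.
Let p_gt1 : 1 < p := prime_gt1 p_pr.

Lemma commg_res_sub : W \subset Q. Proof. by rewrite commg_subl. Qed.

Lemma commg_res_normal : W <| N.
Proof.
rewrite /normal (subset_trans commg_res_sub) //.
by rewrite normsR ?ss_res_norm.
Qed.

Lemma commg_res_not_cent : ~~ (B \subset 'C(W)).
Proof.
apply: contra badQ => cWB; apply: (ss_res_cent_chain (H := [~: Q, B]%G)) => //.
by rewrite (normalS commg_res_sub sQN) ?commg_res_normal.
Qed.

Lemma expgS_leq_card (X : {group gT}) k :
  X \subset Q -> p ^ k < #|X| -> p ^ k.+1 <= #|X|.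
Proof.
move=> sXQ; rewrite (card_pgroup (pgroupS sXQ pQ)).
by rewrite ltn_exp2l // leq_exp2l.
Qed.

Lemma prime_index_res (X : {group gT}) :
  X <| N -> X \subset Q -> #|Q : X| = p -> W \subset X.
Proof.
move=> nsXN sXQ iQX; apply: ss_res_comm_index iQX => //.
exact: normalS nsXN.
Qed.

Lemma maxnormal_prop (U : {group gT}) : maxnormal U Q N ->
  [/\ U <| N, U \proper Q & forall Y : {group gT},
      Y <| N -> Y \subset Q -> U \subset Y -> Y :=: U \/ Y :=: Q].
Proof.
case/maxgroupP=> /andP[prU nUN] maxU; have sUQ := proper_sub prU.
split=> // [|Y /andP[_ nYN] sYQ sUY]; first by rewrite /normal (subset_trans sUQ).
have [-> | neqYQ] := eqVneq (Y : {set gT}) Q; first by right.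
by left; apply: maxU; rewrite // nYN properEneq sYQ !andbT.
Qed.

Lemma abelian_setI_normal (H M : {group gT}) :
  abelian Q -> H \subset Q -> H * M = N -> Q :&: M <| N.
Proof.
move=> cQQ sHQ defN; rewrite /normal subIset ?sQN //= -{1}defN.
have sMN: M \subset N by rewrite -defN mulG_subr.
rewrite mul_subG //; last by rewrite normsI ?normG ?(subset_trans sMN).
by rewrite cents_norm // (sub_abelian_cent2 cQQ) ?subsetIl.
Qed.

Lemma supplement_setI (H M : {group gT}) : H \subset Q -> H * M = N ->
  H * (Q :&: M) = Q /\ (#|H| * #|Q :&: M| = #|Q| * #|H :&: M|)%N.
Proof.
move=> sHQ defN; have defQ: H * (Q :&: M) = Q.
  by rewrite setIC group_modl // defN (setIidPr sQN).
by split=> //; rewrite mul_cardG defQ setIA (setIidPl sHQ).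
Qed.

(** A normal subgroup of [N] inside [Q] lies in [U] or covers [Q / U]. Since [H] does not cover
    [Q / U], neither does [H :&: M]. The [R] of [normal_supplement] must cover it, as otherwise Q =
    HR would lie in HU. *)
Lemma maxnormal_suppl (U H M : {group gT}) :
    maxnormal U Q N -> H \subset Q -> H * M = N -> H :&: M <| N ->
    ~~ (H \subset U) -> ~~ (Q \subset H * U) ->
  H :&: M \subset U /\
  exists R : {group gT}, [/\ R <| N, R \proper Q, H * R = Q & R * U = Q].
Proof.
move=> maxU sHQ defN nsTN not_sHU not_sQHU.
have [nsUN prU max_U] := maxnormal_prop maxU; have sUQ := proper_sub prU.
have maxU' (Y : {group gT}) : Y <| N -> Y \subset Q -> Y \subset U \/ Y * U = Q.
  move=> nsYN sYQ; have sUN := normal_sub nsUN.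
  have nUY: Y \subset 'N(U) by rewrite (subset_trans _ (normal_norm nsUN)) ?normal_sub.
  have nsYU: Y <*> U <| N by rewrite normalY.
  have [||defU | defQ] := max_U _ nsYU.
  - by rewrite join_subG sYQ.
  - exact: joing_subr.
  - by left; rewrite -defU joing_subl.
  by right; rewrite -norm_joinEl.
have sTU: H :&: M \subset U.
  have [|//|defQ] := maxU' (H :&: M)%G nsTN; first by rewrite subIset ?sHQ.
  by case/negP: not_sQHU; rewrite -defQ mulSg ?subsetIl.
split=> //; have neqMN: M :!=: N.
  apply: contraNneq not_sHU => defM; apply: subset_trans sTU.
  by rewrite subsetI subxx defM (subset_trans sHQ).
have [R [nsRN prR defQ]] := normal_supplement pQ nsQN sHQ defN neqMN.
exists R; split=> //; have [|sRU|//] := maxU' R nsRN; first exact: proper_sub.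
by case/negP: not_sQHU; rewrite -{1}defQ mulgS.
Qed.

(** Otherwise a maximal invariant [U] over [W] forces |Q| = p^(e+1), so [Q] is abelian. A supplement
    of a maximal subgroup [H] that misses [W] then leads to a normal subgroup of order p containing
    [W], which [B] would centralize. *)
Lemma large_commg_res : p ^ e < #|W|.
Proof.
rewrite ltnNge; apply/negP => leWe.
have prW: W \proper Q.
  by rewrite properEcard commg_res_sub (leq_ltn_trans leWe).
have [U maxU sWU] := maxnormal_exists (normal_norm commg_res_normal) prW.
have [nsUN prU _] := maxnormal_prop maxU; have sUQ := proper_sub prU.
have iQU := maxnormal_index_prime p_pr pQ nsQN maxU sWU.
have badU: ~~ (B \subset 'C(U)).
  by apply: contra commg_res_not_cent => cUB; rewrite (subset_trans cUB) ?centS.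
have leUe: #|U| <= p ^ e by rewrite leqNgt; apply: contra badU; apply: F1.
have oQU: (#|Q| = #|U| * p)%N by rewrite -iQU Lagrange.
have oQ: #|Q| = (p ^ e.+1)%N.
  apply/eqP; rewrite eqn_leq expgS_leq_card // andbT oQU mulnC expnS.
  by rewrite leq_pmul2l.
have [cQQ _] := hypQ (subxx Q) (or_intror oQ).
have [H maxH not_sWH]: exists2 H : {group gT}, maximal H Q & ~~ (W \subset H).
  have: ~~ (W \subset 'Phi(Q)) by apply: contra badQ; apply: ss_res_cent_Phi.
  case/subsetPn=> x Wx; rewrite /Frattini => PhiQx.
  suff /existsP[H /andP[maxH Hx]]: [exists H : {group gT}, maximal H Q && (x \notin H)].
    by exists H => //; apply: contra Hx => /subsetP->.
  apply: contraR PhiQx; rewrite negb_exists => /forallP noH.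
  apply/bigcapP=> H /predU1P[-> | maxH]; first exact: (subsetP commg_res_sub).
  by have:= noH H; rewrite maxH negbK.
have sHQ := proper_sub (maxgroupp maxH); have iQH := p_maximal_index pQ maxH.
have oH: #|H| = (p ^ e)%N.
  by apply/eqP; rewrite -(eqn_pmul2r p_gt0) -{1}iQH Lagrange // oQ expnSr.
have [_ [M defN nsTN]] := hypQ sHQ (or_introl oH).
have [defQ oY] := supplement_setI sHQ defN.
have nsYN := abelian_setI_normal cQQ sHQ defN.
have [sHM | not_sHM] := boolP (H \subset M).
  case/negP: not_sWH; apply: prime_index_res => //.
  by rewrite -(setIidPl sHM).
have ltTH: #|H :&: M| < p ^ e.
  by rewrite -oH proper_card // properE subsetIl subsetI subxx.
have [T1 | ntT] := eqVneq (H :&: M) 1; last first.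
  case/negP: not_sWH; apply: subset_trans (subsetIl H M).
  by apply: F2 => //; rewrite subIset ?sHQ.
have oYp: #|Q :&: M| = p.
  move: oY; rewrite T1 cards1 muln1 oH oQ expnSr => /eqP.
  by rewrite eqn_pmul2l ?expn_gt0 ?p_gt0 // => /eqP.
have good_p (L : {group gT}) : L <| N -> #|L| = p -> W \subset L -> False.
  move=> nsLN oL sWL; case/negP: commg_res_not_cent.
  apply: subset_trans (centS sWL).
  by apply: ss_res_cent_prime; rewrite ?normal_norm.
(* [F2] reaches a subgroup of order p only if e > 1; for e = 1, [U] itself has order p. *)
have [e1 | ne1] := eqVneq e 1%N.
  apply: (good_p U) => //; move: oQU; rewrite oQ e1 expnS expn1 => /eqP.
  by rewrite eqn_pmul2r // => /eqP.
apply: (good_p (Q :&: M)%G) => //; apply: F2; rewrite ?subsetIl //=.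
  by rewrite -cardG_gt1 oYp.
by rewrite oYp -{1}[p]expn1 ltn_exp2l // ltn_neqAle eq_sym ne1.
Qed.

Lemma commg_res_full : W = Q.
Proof.
apply/eqP; rewrite eqEproper commg_res_sub; apply/negP => prW.
by case/negP: commg_res_not_cent; apply: F1 large_commg_res; rewrite ?commg_res_normal.
Qed.

Lemma no_proper_res (X : {group gT}) : X \proper Q -> W \subset X -> False.
Proof. by rewrite commg_res_full properE => /andP[_ /negP]. Qed.

(** Modulo [R], [U] covers [Q]; if [B] centralized [U], then [Q,B] = Q would lie in [R]. *)
Lemma no_good_cofactor (R U : {group gT}) :
    R <| N -> R \proper Q -> U \subset Q -> Q \subset R * U ->
  ~~ (B \subset 'C(U)).
Proof.
move=> nsRN prR sUQ sQRU; apply/negP => cUB; apply: (no_proper_res prR).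
have [sRN nRN] := andP nsRN.
have [nRQ nRU nRB]: [/\ Q \subset 'N(R), U \subset 'N(R) & B \subset 'N(R)].
  by rewrite !(subset_trans _ nRN) // (subset_trans sUQ).
rewrite -quotient_cents2 //; apply: subset_trans (quotientS R sQRU) _.
by rewrite quotientMidl quotient_cents // centsC.
Qed.

Lemma small_normal (L : {group gT}) :
  L <| N -> L \proper Q -> L :!=: 1 -> p ^ e <= #|L|.
Proof.
move=> nsLN prL ntL; rewrite leqNgt; apply/negP=> ltLe.
by apply: (no_proper_res prL); apply: F2; rewrite ?proper_sub.
Qed.

(** If [B] centralized [U], the [R] of [maxnormal_suppl] would contradict [no_good_cofactor]. The
    work is to find an [H] of admissible order, outside [U], with HU different from [Q]; for
    nontrivial [U] it is taken inside <z>U with z = [x,b] outside [U]. *)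
Lemma maxnormal_bad (U : {group gT}) : maxnormal U Q N -> ~~ (B \subset 'C(U)).
Proof.
move=> maxU; apply/negP=> cUB.
have [nsUN prU _] := maxnormal_prop maxU; have sUQ := proper_sub prU.
have nsUQ: U <| Q := normalS sUQ sQN nsUN.
suff [H [sHQ oH not_sHU not_sQHU]]: exists H : {group gT},
    [/\ H \subset Q, #|H| = (p ^ e)%N \/ #|H| = (p ^ e.+1)%N,
        ~~ (H \subset U) & ~~ (Q \subset H * U)].
  have [_ [M defN nsTN]] := hypQ sHQ oH.
  have [_ [R [nsRN prR _ defQ]]] := maxnormal_suppl maxU sHQ defN nsTN not_sHU not_sQHU.
  by have:= no_good_cofactor nsRN prR sUQ; rewrite defQ cUB => /(_ (subxx _)).
have [U1 | ntU] := eqVneq (U : {set gT}) 1.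
  have [|H [_ sHQ oH]] := @exists_pgroup_between p e _ 1%G Q pQ (sub1G Q).
    by rewrite cards1 expn_gt0 p_gt0 ltnW.
  exists H; rewrite U1 mulg1 sHQ oH; split; first by []; first by left.
    by rewrite subG1 -cardG_gt1 oH -{1}(expn0 p) ltn_exp2l.
  by apply: contraL lteQ => /subset_leq_card; rewrite oH -leqNgt.
have leeU := small_normal nsUN prU ntU.
have abelQU: p.-abelem (Q / U).
  have minQU: minnormal (Q / U) (N / U).
    by apply: chief_factor_minnormal; rewrite /chief_factor maxU.
  have pQU: p.-group (Q / U) := quotient_pgroup U pQ.
  rewrite -(is_abelem_pgroup pQU).
  exact: charsimple_solvable (minnormal_charsimple minQU) (pgroup_sol pQU).
have nUQ := normal_norm nsUQ.
have sQ'U: Q^`(1) \subset U.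
  by rewrite -quotient_cents2 // -/(abelian (Q / U)) (abelem_abelian abelQU).
have powU: {in Q, forall y, y ^+ p \in U}.
  move=> y Qy; apply: coset_idr; first by rewrite groupX ?(subsetP nUQ).
  by rewrite morphX ?(subsetP nUQ) // (proj2 (abelemP p_pr abelQU)) ?mem_quotient.
(* Three subgroups lemma: Q = [Q,B], while [B,U] and [[U,Q],B] are trivial. *)
have cQU: Q \subset 'C(U).
  rewrite -commg_res_full; apply/commG1P; apply: three_subgroup.
    by move/commG1P: cUB => ->; rewrite comm1G.
  apply/commG1P; rewrite centsC; apply: subset_trans cUB (centS _).
  by rewrite commg_subl.
have: ~~ (W \subset U) by apply/negP; apply: no_proper_res.
rewrite gen_subG => /subsetPn[_ /imset2P[x b Qx Bb ->]]; set z := [~ x, b] => U'z.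
have Qz: z \in Q by rewrite (subsetP commg_res_sub) ?mem_commg.
have zp2: z ^+ (p ^ 2) = 1.
  by apply: (commg_expn_square p_pr sQ'U cQU powU Qx); rewrite ?(subsetP nQB) ?(subsetP cUB).
have nUz: <[z]> \subset 'N(U) by rewrite cycle_subG (subsetP nUQ).
have ozU: (#|<[z]> <*> U| = p * #|U|)%N.
  have ntz: coset U z != 1.
    by apply: contra U'z => /eqP/coset_idr->; rewrite ?(subsetP nUQ).
  rewrite norm_joinEl // -LagrangeMr -card_quotient //=.
  rewrite quotient_cycle ?(subsetP nUQ) // -orderE.
  by rewrite (abelem_order_p abelQU) ?mem_quotient.
have szUQ: <[z]> <*> U \subset Q by rewrite join_subG cycle_subG Qz.
have [|H [szH sHzU oH]] :=
    @exists_pgroup_between p e.+1 _ _ _ (pgroupS szUQ pQ) (joing_subl <[z]> U).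
  (* The order of [z] is at most p^2 <= p^(e+1), as e >= 1; this is why [x,b]^(p^2) = 1 was
     needed. *)
  rewrite ozU expnS leq_pmul2l // leeU andbT -expnS -orderE.
  apply: leq_trans (_ : p ^ 2 <= _); last by rewrite leq_exp2l.
  by rewrite dvdn_leq ?order_dvdn ?zp2 ?expn_gt0 ?p_gt0.
exists H; split; [exact: subset_trans sHzU szUQ | by right | |].
  by apply: contra U'z => /subsetP->; rewrite // (subsetP szH) ?cycle_id.
apply/negP=> sQHU; apply: (no_proper_res prU); apply: prime_index_res => //.
have eqQ: <[z]> <*> U = Q.
  apply/eqP; rewrite eqEsubset szUQ (subset_trans sQHU) //.
  by rewrite mul_subG ?joing_subr.
apply/eqP; rewrite -(eqn_pmul2l (cardG_gt0 U)) Lagrange // -{1}eqQ ozU mulnC.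
by [].
Qed.

(** [U] and the second cofactor [R] both have order p^e and meet trivially, so [Q] is their direct
    product and abelian. Then Q :&: M is normal in [N], and T = H :&: M is 1 or [U]. If T = 1, Q :&:
    M has order p^(e-1), hence is trivial, against e > 1. If T = U, it has order p^(2e-1) > p^e and
    contains [U], so [B] centralizes [U]. *)
Lemma minimal_counterexample : False.
Proof.
have prQ1: 1%G \proper Q.
  by rewrite proper1G -cardG_gt1 (leq_ltn_trans _ lteQ) // expn_gt0 p_gt0.
have [U maxU _] := maxnormal_exists (norms1 N) prQ1.
have badU := maxnormal_bad maxU.
have [nsUN prU _] := maxnormal_prop maxU; have sUQ := proper_sub prU.
have nsUQ: U <| Q := normalS sUQ sQN nsUN.
have card_e (X : {group gT}) : X <| N -> X \proper Q -> X :!=: 1 ->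
    ~~ (B \subset 'C(X)) -> #|X| = (p ^ e)%N.
  move=> nsXN prX ntX badX; apply/eqP; rewrite eqn_leq small_normal // andbT.
  by rewrite leqNgt; apply: contra badX; apply: F1.
have oU: #|U| = (p ^ e)%N.
  by apply: card_e => //; apply: contraNneq badU => ->; apply: cents1.
have e_gt1: 1 < e.
  rewrite ltn_neqAle e_gt0 andbT; apply: contraNneq badU => e1.
  by apply: ss_res_cent_prime; rewrite ?normal_norm // oU -e1 expn1.
have [|H [sUH sHQ oH]] := @exists_pgroup_between p e.+1 _ _ _ pQ sUQ.
  by rewrite oU leq_exp2l // leqnSn expgS_leq_card.
have not_sHU: ~~ (H \subset U).
  by apply/negP=> /subset_leq_card; rewrite oU oH leq_exp2l // ltnn.
have not_sQHU: ~~ (Q \subset H * U).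
  rewrite mulGSid //; apply/negP=> sQH; apply: (no_proper_res prU).
  apply: prime_index_res => //; apply/eqP.
  have eqQH: H :=: Q by apply/eqP; rewrite eqEsubset sHQ.
  by rewrite -(eqn_pmul2l (cardG_gt0 U)) Lagrange // -eqQH oH oU expnSr.
have [_ [M defN nsTN]] := hypQ sHQ (or_intror oH).
have [sTU [R [nsRN prR defHR defRU]]] := maxnormal_suppl maxU sHQ defN nsTN not_sHU not_sQHU.
have sRQ := proper_sub prR.
have oR: #|R| = (p ^ e)%N.
  apply: card_e => //.
    apply: contraNneq not_sQHU => R1; move: defHR; rewrite R1 mulg1 => ->.
    exact: mulG_subl.
  apply: (no_good_cofactor nsUN prU sRQ).
  by rewrite (normC _) ?defRU // (subset_trans sUQ) // (subset_trans sQN) ?normal_norm.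
have nRU: U \subset 'N(R).
  by rewrite (subset_trans sUQ) // (subset_trans sQN) ?normal_norm.
have ltRUe (X : {group gT}) : X <| N -> X \subset Q -> #|X| < p ^ e -> X :=: 1.
  move=> nsXN sXQ ltXe; apply/eqP/idPn => ntX.
  have prX: X \proper Q by rewrite properEcard sXQ (ltn_trans ltXe).
  by have:= small_normal nsXN prX ntX; rewrite leqNgt ltXe.
have tiRU: R :&: U = 1.
  apply: (ltRUe (R :&: U)%G); rewrite ?normalI //= ?subIset ?sRQ //.
  rewrite -oU proper_card // properE subsetIr subsetI subxx andbT.
  by apply: contra (proper_subn prR) => sUR; rewrite -defRU mul_subG.
have cUU: abelian U.
  by have [] := hypQ sUQ (or_introl oU).
have cRR: abelian R.
  by have [] := hypQ sRQ (or_introl oR).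
have cRU: U \subset 'C(R).
  apply/commG1P/trivgP; rewrite -tiRU subsetI commg_subr commg_subl nRU.
  by rewrite (subset_trans sRQ) // (subset_trans sQN) ?normal_norm.
have cQQ: abelian Q by rewrite -defRU abelianM cRR cUU.
have oQ: #|Q| = (p ^ e * p ^ e)%N by rewrite -defRU TI_cardMg // oR oU.
have nsXN := abelian_setI_normal cQQ sHQ defN.
have [defQ oX] := supplement_setI sHQ defN.
have prX: Q :&: M \proper Q.
  rewrite properEneq subsetIl andbT; apply: contra not_sHU => /eqP/setIidPl sQM.
  by apply: subset_trans sTU; rewrite subsetI subxx (subset_trans sHQ).
have [T1 | ntT] := eqVneq (H :&: M) 1.
  have oX1: #|Q :&: M| = (p ^ e.-1)%N.
    apply/eqP; rewrite -(eqn_pmul2l (cardG_gt0 H)) oX T1 cards1 muln1 oQ oH.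
    by rewrite -!expnD addSnnS prednK.
  have X1: Q :&: M = 1.
    by apply: (ltRUe (Q :&: M)%G); rewrite ?subsetIl //= oX1 ltn_exp2l // prednK.
  by move/eqP: oX1; rewrite X1 cards1 eq_sym -(expn0 p) eqn_exp2l //; case: (e) e_gt1 => [|[]].
have eqTU: H :&: M = U.
  apply/eqP; rewrite eqEcard sTU oU leqNgt; apply: contra ntT => ltT.
  by rewrite [H :&: M](ltRUe (H :&: M)%G) //= subIset ?sHQ.
have oX2: (#|Q :&: M| * p = p ^ e * p ^ e)%N.
  move/eqP: oX; rewrite oH eqTU oU oQ expnSr -!mulnA.
  by rewrite eqn_pmul2l ?expn_gt0 ?p_gt0 // mulnC => /eqP.
case/negP: badU; apply: (subset_trans (F1 nsXN prX _)).
  rewrite -(ltn_pmul2r p_gt0) oX2 -expnSr -expnD ltn_exp2l //.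
  by rewrite -addn1 ltn_add2l.
by rewrite centS // -eqTU setSI.
Qed.

End MinimalCounterexample.

Lemma csuppl_hyp_quotient (p e l : nat) (gT : finGroupType) (N Q L : {group gT}) :
    L <| N -> L \subset Q -> Q \subset N -> #|L| = (p ^ l)%N -> l <= e ->
  csuppl_hyp p e N Q -> csuppl_hyp p (e - l) (N / L)%G (Q / L)%G.
Proof.
move=> nsLN sLQ sQN oL le_le hypQ Hb sHbQ oHb.
have nsLQ : L <| Q := normalS sLQ sQN nsLN.
have [H defH sLH sHQ] := inv_quotientS nsLQ sHbQ.
have nLH : H \subset 'N(L) := subset_trans sHQ (normal_norm nsLQ).
have oH : (#|H| = #|Hb| * p ^ l)%N.
  by rewrite defH card_quotient // -oL mulnC Lagrange.
have [|cHH supH] := hypQ H sHQ.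
  by case: oHb => oHb; [left | right]; rewrite oH oHb -expnD ?addSn subnK.
have -> : Hb = (H / L)%G by apply: val_inj.
by split; [apply: quotient_abelian | apply: c_supplemented_quotient].
Qed.

Theorem ss_res_cent_normal_pgroup (p e : nat) (gT : finGroupType) (N Q : {group gT}) :
    prime p -> p.-group Q -> Q <| N -> 0 < e -> p ^ e < #|Q| ->
  csuppl_hyp p e N Q -> ss_res p N \subset 'C(Q).
Proof.
move=> p_pr; have [n leQn] := ubnP #|Q|.
(* The group type and [e] vary too, since the induction also uses [N / L]. *)
elim: n => // n IHn in gT N Q e leQn * => pQ nsQN e_gt0 lteQ hypQ.
have p_gt1 := prime_gt1 p_pr; have sQN := normal_sub nsQN.
apply/idPn => badQ.
apply: (@minimal_counterexample p e gT N Q p_pr pQ nsQN e_gt0 lteQ hypQ _ _ badQ).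
  move=> X nsXN prX lteX; have sXQ := proper_sub prX.
  apply: (IHn _ N X e) lteX _ => //.
  - exact: leq_trans (proper_card prX) leQn.
  - exact: pgroupS pQ.
  by move=> H sHX; apply: hypQ; apply: subset_trans sXQ.
move=> L nsLN sLQ ntL; have pL := pgroupS sLQ pQ.
have oL := card_pgroup pL; set l := logn p #|L| in oL.
rewrite oL ltn_exp2l // => lt_le; have [sLN nLN] := andP nsLN.
have l_gt0: 0 < l by rewrite -(ltn_exp2l _ _ p_gt1) -oL cardG_gt1.
have nLQ : Q \subset 'N(L) := subset_trans sQN nLN.
have oQL: (#|Q / L| * p ^ l = #|Q|)%N.
  by rewrite card_quotient // -oL mulnC Lagrange.
rewrite -quotient_cents2 ?(subset_trans (ss_res_sub p N)) // centsC.
apply: subset_trans (quotient_ss_res p nsLN) _.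
apply: (IHn _ (N / L)%G (Q / L)%G (e - l)).
- exact: leq_trans (ltn_quotient ntL sLQ) leQn.
- exact: quotient_pgroup.
- exact: quotient_normal.
- by rewrite subn_gt0.
- have pl_gt0: 0 < p ^ l by rewrite expn_gt0 prime_gt0.
  by rewrite -(ltn_pmul2r pl_gt0) oQL -expnD subnK // ltnW.
by apply: csuppl_hyp_quotient; rewrite // ltnW.
Qed.

(** * Pronormality and control of fusion *)

(* If T is pronormal then T is normal in every Y in which it is subnormal;   *)
(* in the p-group R the normalizer of T is therefore self-normalizing.       *)
Lemma pronormal_normal_pgroup (p : nat) (gT : finGroupType) (G R T : {group gT}) :
    p.-group R -> R \subset G -> T \subset R -> pronormal G T -> R \subset 'N(T).
Proof.
move=> pR sRG sTR [_ prT]; apply/setIidPl/esym.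
apply: (nilpotent_sub_norm (pgroup_nil pR)); rewrite ?subsetIl //.
apply/subsetP=> y /setIP[Ry nRy]; rewrite inE Ry.
have [x Tx defTy] := prT y (subsetP sRG y Ry).
apply/normP; rewrite defTy; apply/normP; move: Tx; apply/subsetP.
rewrite join_subG normG (subset_trans _ (subsetIr R _)) //.
have <- : 'N_R(T) :^ y = 'N_R(T) by apply/normP.
by rewrite conjSg subsetI sTR normG.
Qed.

(** [T] and its conjugate under [N] both lie in [R], so they are conjugate inside [R], which
    normalizes [T]. *)
Lemma pronormal_normal (p : nat) (gT : finGroupType) (G N R T : {group gT}) :
    p.-group R -> R <| N -> N \subset G -> T \subset R -> pronormal G T ->
  T <| N.
Proof.
move=> pR /andP[sRN nRN] sNG sTR prT; rewrite /normal (subset_trans sTR) //=.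
have sRG := subset_trans sRN sNG.
have nTR := pronormal_normal_pgroup pR sRG sTR prT.
have [_ conjT] := prT; apply/normsP=> y Ny.
have [x Tx ->] := conjT y (subsetP sNG y Ny).
apply/normP; apply: subsetP nTR _ _; move: Tx; apply/subsetP.
by rewrite join_subG sTR -(normsP nRN y Ny) conjSg.
Qed.

Lemma weakly_pronormal_c_supplemented (p : nat) (gT : finGroupType)
    (G N R H : {group gT}) :
    p.-group R -> R <| N -> N \subset G -> H \subset R ->
  weakly_pronormal G H -> c_supplemented N H.
Proof.
move=> pR nsRN sNG sHR [_ [K [sKG defG prT]]].
have sHN := subset_trans sHR (normal_sub nsRN).
exists (K :&: N)%G; first by rewrite /= group_modl // defG (setIidPr sNG).
have -> : H :&: (K :&: N)%G = (H :&: K)%G by rewrite /= setIA setIAC (setIidPl sHN).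
by apply: pronormal_normal pR nsRN sNG _ prT; rewrite subIset ?sHR.
Qed.

Section ControlOfFusion.

Variables (p : nat) (gT : finGroupType) (G S : {group gT}).
Hypothesis sylS : p.-Sylow(G) S.
Hypothesis centric_normal : forall R : {group gT},
    R \subset S -> 'C_S(R) \subset R -> p.-Sylow('N_G(R)) 'N_S(R) ->
  'C_G(R) <*> 'N_S(R) <| 'N_G(R).

Let sSG : S \subset G := pHall_sub sylS.
Let pS : p.-group S := pHall_pgroup sylS.

(** Frattini's argument: for centric [R], in 'C_G(R)'N_S(R) with X = 'N_S(R); otherwise in 'C_G(R),
    with X generated by [R] and a Sylow subgroup of 'C_G(R) not inside [R]. *)
Lemma Sylow_norm_factor (R : {group gT}) :
    R \proper S -> p.-Sylow('N_G(R)) 'N_S(R) ->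
  exists X : {group gT},
    [/\ R \proper X, X \subset S & 'N_G(R) \subset 'C_G(R) * 'N_('N_G(R))(X)].
Proof.
move=> prR sylA; have sRS := proper_sub prR.
have nsCN: 'C_G(R) <| 'N_G(R).
  rewrite /normal setIS ?cent_sub //.
  by rewrite normsI ?norms_cent ?subsetIr ?subIset ?normG.
have [sCR | not_sCR] := boolP ('C_S(R) \subset R).
  exists 'N_S(R)%G; split; last 1 first.
  - have nsJN := centric_normal sRS sCR sylA.
    have sylJ: p.-Sylow('C_G(R) <*> 'N_S(R)) 'N_S(R).
      by apply: pHall_subl sylA; rewrite ?joing_subr ?normal_sub.
    rewrite -{1}(Frattini_arg nsJN sylJ) /= norm_joinEr; last first.
      by apply: subset_trans (normal_norm nsCN); rewrite setSI.
    by rewrite -mulgA mulgS // mul_subG // subsetI setSI // normG.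
  - exact: nilpotent_proper_norm (pgroup_nil pS) prR.
  exact: subsetIl.
have sylC := Hall_setI_normal nsCN sylA.
exists (R <*> ('N_S(R) :&: 'C_G(R)))%G; split.
- rewrite properE joing_subl join_subG subxx /=; apply: contra not_sCR.
  apply: subset_trans; rewrite !subsetI subsetIl subsetIr.
  rewrite (subset_trans _ (cent_sub R)) ?subsetIr //.
  by rewrite subIset ?sSG.
- by rewrite join_subG sRS subIset // subsetIl.
rewrite -{1}(Frattini_arg nsCN sylC) mulgS // subsetI subsetIl /=.
apply: subset_trans (_ : 'N(R) :&: 'N('N_S(R) :&: 'C_G(R)) \subset _).
  by rewrite setSI ?subsetIr.
exact: normsY (subsetIl _ _) (subsetIr _ _).
Qed.

(** Induction on |S| - |P|, as in Alperin's theorem: [P] is moved to a conjugate [R] whose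
    normalizer in [S] is Sylow in 'N_G(R), and conjugation by [g] is factored into maps that extend
    to larger subgroups of [S]. *)
Lemma control_norm_Sylow (P : {group gT}) g :
    P \subset S -> g \in G -> P :^ g \subset S ->
  exists2 n, n \in 'N_G(S) & {in P, forall x, x ^ g = x ^ n}.
Proof.
have [m] := ubnP (#|S| - #|P|); elim: m => // m IHm in P g *.
rewrite ltnS => lePm sPS Gg sPgS.
have [eqPS | neqPS] := eqVneq (P : {set gT}) S.
  exists g => //; rewrite inE Gg; apply/normP/eqP.
  by rewrite eqEcard cardJg leqnn -{1}eqPS sPgS.
have IH (X : {group gT}) h : #|P| < #|X| -> X \subset S -> h \in G -> X :^ h \subset S ->
    exists2 n, n \in 'N_G(S) & {in X, forall x, x ^ h = x ^ n}.
  move=> ltPX sXS; apply: IHm => //; apply: leq_trans lePm.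
  by rewrite ltn_sub2l // (leq_trans ltPX) ?subset_leq_card.
have growN (X : {group gT}) : X \subset S -> #|X| = #|P| -> #|P| < #|'N_S(X)|.
  move=> sXS oX; rewrite -oX proper_card // nilpotent_proper_norm ?(pgroup_nil pS) //.
  by rewrite properEcard sXS oX proper_card // properEneq neqPS.
have [Q sylQ sNPQ] : {Q : {group gT} | p.-Sylow('N_G(P)) Q & 'N_S(P) \subset Q}.
  have sNN: 'N_S(P) \subset 'N_G(P) by rewrite setSI.
  by have [Q] := Sylow_superset sNN (pgroupS (subsetIl S _) pS); exists Q.
have sQG: Q \subset G := subset_trans (pHall_sub sylQ) (subsetIl _ _).
have [h Gh sQhS] := Sylow_Jsub sylS sQG (pHall_pgroup sylQ).
have sPQ: P \subset Q by rewrite (subset_trans _ sNPQ) // subsetI sPS normG.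
pose R := (P :^ h)%G.
have sRS: R \subset S by rewrite (subset_trans _ sQhS) // conjSg.
have prR: R \proper S by rewrite properEcard sRS cardJg proper_card // properEneq neqPS.
have sylR: p.-Sylow('N_G(R)) 'N_S(R).
  have sylQh: p.-Sylow('N_G(R)) (Q :^ h).
    by rewrite /= normJ -{1}(conjGid Gh) -conjIg pHallJ2.
  have sQhN: Q :^ h \subset 'N_S(R).
    by rewrite subsetI sQhS normJ conjSg (subset_trans (pHall_sub sylQ)) ?subsetIr.
  rewrite (sub_pHall sylQh _ sQhN) ?setSI //.
  exact: pgroupS (subsetIl _ _) pS.
have actR k : k \in 'N_G(R) -> exists2 n, n \in 'N_G(S) & {in R, forall x, x ^ k = x ^ n}.
  have [X [prX sXS sNCN]] := Sylow_norm_factor prR sylR.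
  move/(subsetP sNCN)=> /mulsgP[c n /setIP[_ cRc] /setIP[/setIP[Gn _] nXn] ->].
  have [||||n3 Nn3 n3E] := IH X n; rewrite ?(normP nXn) //.
    by rewrite -(cardJg P h) proper_card.
  exists n3 => // x Rx; rewrite conjgM -n3E ?(subsetP (proper_sub prX)) //.
  by rewrite [x ^ c]conjgE -(centP cRc) ?mulKg.
have sNPg: 'N_S(P :^ g) :^ g^-1 \subset 'N_G(P).
  by rewrite conjIg -normJ conjsgK setSI // -(conjGid (groupVr Gg)) conjSg.
have pNPg: p.-group ('N_S(P :^ g) :^ g^-1) by rewrite pgroupJ (pgroupS (subsetIl _ _) pS).
have [k /setIP[Gk nPk] sNPgkQ] := Sylow_Jsub sylQ sNPg pNPg.
have [||||n1 Nn1 n1E] := IH 'N_S(P)%G h; rewrite ?growN ?subsetIl //.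
  by rewrite (subset_trans _ sQhS) ?conjSg.
have [||||n2 Nn2 n2E] := IH 'N_S(P :^ g)%G (g^-1 * k * h);
  rewrite ?subsetIl ?groupM ?groupV //.
- by apply: (growN (P :^ g)%G); rewrite ?cardJg.
- by rewrite !conjsgM (subset_trans _ sQhS) // conjSg.
have [|n3 Nn3 n3E] := actR (k ^ h).
  by rewrite inE groupJ //= normJ memJ_conjg.
(* This mirrors g = h * k^h * (g^-1 k h)^-1. *)
exists (n1 * n3 * n2^-1); first by rewrite !groupM ?groupV.
move=> x Px; rewrite !conjgM -n1E ?(subsetP _ x Px) ?subsetI ?sPS ?normG //.
rewrite -n3E ?memJ_conjg //; apply: (canRL (conjgK n2)).
rewrite -n2E; last by rewrite inE (subsetP sPgS) ?memJ_conjg ?(subsetP (normG _)) ?memJ_conjg.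
by rewrite -!conjgM -[in LHS]mulgA mulKVg -conjgC.
Qed.

End ControlOfFusion.

(** The image of [K] in [N / C] is a normal p-subgroup, hence lies in that of [A]. So CA contains
    [K], and with it the derived subgroup of [N]. *)
Lemma ss_res_cent_Sylow_normal (p : nat) (gT : finGroupType) (N C A : {group gT}) :
    C <| N -> p.-Sylow(N) A -> ss_res p N \subset C -> C <*> A <| N.
Proof.
move=> /andP[sCN nCN] sylA sBC; have sAN := pHall_sub sylA.
apply: sub_der1_normal; last by rewrite join_subG sCN.
apply: subset_trans (der1_abexp_res p N) _; set K := abexp_res_group p N.
have nCK: K \subset 'N(C) := subset_trans (abexp_res_sub p N) nCN.
have pKC: p.-group (K / C).
  apply: pgroup_quotient_p'_elt => // x Kx p'x.
  by rewrite -cycle_subG (subset_trans _ sBC) ?cycle_sub_ss_res.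
have nCA := subset_trans sAN nCN.
rewrite /= norm_joinEr // -quotientSK //.
apply: normal_sub_max_pgroup (Hall_max (quotient_pHall nCA sylA)) pKC _.
by rewrite quotient_normal // /normal abexp_res_sub abexp_res_norm.
Qed.

(** * The invariant chain and the theorem *)

Lemma cyclic_normal_chain (p : nat) (gT : finGroupType) (N Q : {group gT}) :
    prime p -> p.-group Q -> Q <| N -> ss_res p N \subset 'C(Q) ->
  exists (m : nat) (T : nat -> {group gT}),
    [/\ T 0 = 1%G, T m = Q,
        forall i, i <= m -> T i \subset Q /\ N \subset 'N(T i)
      & forall i, i < m -> T i \subset T i.+1 /\ cyclic (T i.+1 / T i)].
Proof.
move=> p_pr; have [n] := ubnP #|Q|.
elim: n Q => // n IHn Q leQn pQ nsQN cQB.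
have [Q1 | ntQ] := eqVneq (Q : {set gT}) 1.
  exists 0, (fun=> 1%G); split=> //; first exact/esym/val_inj.
  by move=> i _; rewrite sub1G norms1.
have prQ1: 1%G \proper Q by rewrite properEneq sub1G eq_sym ntQ.
have [U maxU _] := maxnormal_exists (norms1 N) prQ1.
have [/andP[prU nUN] _] := maxgroupP maxU; have sUQ := proper_sub prU.
have sQN := normal_sub nsQN.
have iQU: #|Q : U| = p.
  apply: maxnormal_index_prime maxU _ => //.
  by move: cQB; rewrite centsC => /commG1P->; apply: sub1G.
have [||||m [T [T0 Tm nT cT]]] := IHn U.
- exact: leq_trans (proper_card prU) leQn.
- exact: pgroupS pQ.
- by rewrite /normal nUN (subset_trans sUQ).
- exact: subset_trans cQB (centS sUQ).
exists m.+1, (fun i => if i <= m then T i else Q); split=> [|||i].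
- by rewrite T0.
- by rewrite ltnn.
- move=> i _; case: ifP => [/nT[sTU nTN]|_]; last by rewrite normal_norm.
  by rewrite (subset_trans sTU).
move=> le_im; have /predU1P[-> | ltim]: (i == m) || (i < m) by rewrite -leq_eqVlt.
  rewrite /= leqnn ltnn Tm; split=> //; apply: prime_cyclic.
  by rewrite card_quotient ?iQU // (subset_trans sQN).
by rewrite /= (ltnW ltim) ltim; apply: cT.
Qed.

Theorem theorem1 (gT : finGroupType) (G S : {group gT}) (p : nat)
    (p_pr : prime p) (sylS : p.-Sylow(G) S)
    (hD : exists D : {group gT},
      [/\ 1%G \proper D, D \proper S &
          forall H : {group gT}, H \subset S ->
            #|H| = #|D| \/ #|H| = (p * #|D|)%N ->
            abelian H /\ weakly_pronormal G H]) :
  supersolvable_fusion (group_fusion (pHall_sub sylS)).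
Proof.
have [D [ntD prD hypD]] := hD; have p_gt1 := prime_gt1 p_pr.
have [sSG pS _] := and3P sylS; have sDS := proper_sub prD.
have oD := card_pgroup (pgroupS sDS pS); set e := logn p #|D| in oD.
have e_gt0: 0 < e.
  by rewrite -(ltn_exp2l _ _ p_gt1) -oD cardG_gt1 -proper1G.
have lteS: p ^ e < #|S| by rewrite -oD proper_card.
have goodR (R N : {group gT}) :
    R \subset S -> R <| N -> N \subset G -> p ^ e < #|R| -> ss_res p N \subset 'C(R).
  move=> sRS nsRN sNG lteR; have pR := pgroupS sRS pS.
  apply: (ss_res_cent_normal_pgroup p_pr pR nsRN e_gt0 lteR) => H sHR.
  rewrite expnS -oD => oH.
  have [cHH wprH] := hypD H (subset_trans sHR sRS) oH.
  by split=> //; apply: weakly_pronormal_c_supplemented pR nsRN sNG sHR wprH.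
(* A centric subgroup of order at most p ^ e would lie in an abelian one of  *)
(* order p ^ e.+1, which centralizes it.                                     *)
have centric_big (R : {group gT}) : R \subset S -> 'C_S(R) \subset R -> p ^ e < #|R|.
  move=> sRS sCR; rewrite ltnNge; apply/negP=> leRe.
  have [|X [sRX sXS oX]] := @exists_pgroup_between p e.+1 _ _ _ pS sRS.
    rewrite (leq_trans leRe) ?leq_exp2l //.
    by rewrite (card_pgroup pS) leq_exp2l // -(ltn_exp2l _ _ p_gt1) -card_pgroup.
  have [|cXX _] := hypD X sXS; first by right; rewrite oX expnS oD.
  have sXR: X \subset R.
    by apply: subset_trans sCR; rewrite subsetI sXS (subset_trans cXX) ?centS.
  by have:= leq_trans (subset_leq_card sXR) leRe; rewrite oX leq_exp2l // ltnn.
have control : forall (P : {group gT}) g, P \subset S -> g \in G -> P :^ g \subset S ->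
    exists2 n, n \in 'N_G(S) & {in P, forall x, x ^ g = x ^ n}.
  apply: (control_norm_Sylow sylS) => R sRS sCR sylR.
  have sRG := subset_trans sRS sSG.
  apply: ss_res_cent_Sylow_normal sylR _.
    by rewrite /normal setIS ?cent_sub ?normsI ?norms_cent ?subsetIr ?subIset ?normG.
  rewrite subsetI (subset_trans (ss_res_sub p _)) ?subsetIl //=.
  apply: goodR => //; rewrite ?subsetIl ?centric_big //.
  by rewrite /normal subsetI sRG normG subsetIr.
have sSN : S <| 'N_G(S) by rewrite /normal subsetI sSG normG subsetIr.
have [m [T [T0 Tm nT cT]]] := cyclic_normal_chain p_pr pS sSN
  (goodR S _ (subxx S) sSN (subsetIl _ _) lteS).
exists m, T; split=> // i le_im; have [sTS nTN] := nT i le_im.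
split=> // P phi sPT [sPS _ sphiS [g Gg phiE]].
have ephi: phi @* P = P :^ g.
  by rewrite morphimEdom; apply: eq_in_imset.
(* Control replaces [g] by an element of 'N_G(S), which normalizes [T i]. *)
have [|n Nn nE] := control P g sPS Gg; first by rewrite -ephi.
apply/subsetP=> _ /morphimP[x _ Px ->]; rewrite phiE // nE //.
by rewrite memJ_norm ?(subsetP nTN) ?(subsetP sPT).
Qed.
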